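(* For all positive integers $m,n$, $$def\left(K_{1,m,n}\right)=\begin{cases}0, & \text{if } \gcd(m+1,n+1)=1,\\ 1, & \text{otherwise.}\end{cases}$$
   Context: $K_{1,m,n}$ is the complete tripartite graph with parts of sizes $1$, $m$ and $n$. A proper $t$-edge-coloring of a graph $G$ is a map $\alpha:E(G)\to\{1,\ldots,t\}$ such that all $t$ colors are used and adjacent edges receive different colors. The spectrum $S(v,\alpha)$ of a vertex $v$ is the set of colors on edges incident to $v$. For a finite set $A$ of integers, $def(A)=\max A-\min A-|A|+1$. Define $def(v,\alpha)=def(S(v,\alpha))$, $def(G,\alpha)=\sum_{v\in V(G)}def(v,\alpha)$, and $def(G)=\min_\alpha def(G,\alpha)$ over all proper edge-colorings $\alpha$ of $G$. *)

(* Defs.v *)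
From mathcomp Require Import all_boot finmap boolp.

Set Implicit Arguments.
Unset Strict Implicit.
Unset Printing Implicit Defensive.

Local Open Scope fset_scope.

Record sgraph := SGraph {
  vertex :> finType;
  adj : rel vertex;
  adj_sym : symmetric adj;
  adj_irr : irreflexive adj
}.

Definition edges (G : sgraph) : {set {set G}} :=
  [set [set x; y] | x in G, y in G & adj x y].

(* Only the values of [alpha] on [edges G] matter. *)
Definition proper_edge_coloring (G : sgraph) (t : nat)
    (alpha : {set G} -> nat) : Prop :=
  [/\ {in edges G, forall e, 1 <= alpha e <= t},
      forall c, 1 <= c <= t -> exists2 e, e \in edges G & alpha e = c
    & {in edges G &, forall e f : {set G},
        e != f -> e :&: f != set0 -> alpha e != alpha f}].

Definition spectrum (G : sgraph) (alpha : {set G} -> nat) (v : G) : {fset nat} :=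
  [fset alpha e | e in [set e in edges G | v \in e]].

Definition fset_max (A : {fset nat}) : nat := \max_(i <- A) i.

(* Starting from the maximum makes the neutral element harmless: this is the
   least element of [A] as soon as [A] is nonempty. *)
Definition fset_min (A : {fset nat}) : nat := \big[minn/fset_max A]_(i <- A) i.

(* max A - min A - |A| + 1, arranged so that truncated subtraction is exact
   for nonempty [A]; the empty set gets the value 0. *)
Definition def_set (A : {fset nat}) : nat :=
  fset_max A - fset_min A - (#|` A| - 1).

Definition def_vertex (G : sgraph) (alpha : {set G} -> nat) (v : G) : nat :=
  def_set (spectrum alpha v).

Definition def_coloring (G : sgraph) (alpha : {set G} -> nat) : nat :=
  \sum_(v : G) def_vertex alpha v.

Definition attained_def (G : sgraph) (d : nat) : Prop :=
  exists t alpha, @proper_edge_coloring G t alpha /\ def_coloring alpha = d.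

Lemma attained_def_ex (G : sgraph) : exists d, `[< attained_def G d >].
Proof.
pose alpha (e : {set G}) := (index e (enum (edges G))).+1.
exists (def_coloring alpha); apply/asboolP; exists #|edges G|, alpha.
split=> //; split=> [e eG | c /andP[c_gt0 c_le] | e f eG fG neq_ef _].
- by rewrite /alpha /= cardE index_mem mem_enum.
- have lt_c : c.-1 < size (enum (edges G)) by rewrite prednK // -cardE.
  exists (nth set0 (enum (edges G)) c.-1); first by rewrite -mem_enum mem_nth.
  by rewrite /alpha index_uniq ?enum_uniq // prednK.
- apply: contraNneq neq_ef => -[eq_ef]; apply/eqP.
  by rewrite -(nth_index set0 (_ : e \in enum (edges G))) ?mem_enum // eq_ef
    nth_index ?mem_enum.
Qed.

Definition deficiency (G : sgraph) : nat := ex_minn (attained_def_ex G).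

Definition tripartite_vertex (l m n : nat) : finType := ('I_l + 'I_m + 'I_n)%type.

Definition part (l m n : nat) (x : tripartite_vertex l m n) : nat :=
  match x with
  | inl (inl _) => 0
  | inl (inr _) => 1
  | inr _ => 2
  end.

Definition tripartite_adj (l m n : nat) : rel (tripartite_vertex l m n) :=
  fun x y => part x != part y.

Lemma tripartite_adj_sym l m n : symmetric (@tripartite_adj l m n).
Proof. by move=> x y; rewrite /tripartite_adj eq_sym. Qed.

Lemma tripartite_adj_irr l m n : irreflexive (@tripartite_adj l m n).
Proof. by move=> x; rewrite /tripartite_adj eqxx. Qed.

Definition complete_tripartite (l m n : nat) : sgraph :=
  SGraph (@tripartite_adj_sym l m n) (@tripartite_adj_irr l m n).

(* Main.v *)
Require Import Defs.
From mathcomp Require Import all_boot.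
From mathcomp Require Import finmap zify.
From mathcomp Require boolp.

(* Write u for the vertex of the singleton part, and x and y for those of the
   other parts; x has degree n + 1, y has degree m + 1, u has degree m + n.

   Let g = gcd (m + 1) (n + 1) > 1. If all spectra were intervals, a residue
   class mod g would be met (n + 1) / g times at each x and (m + 1) / g times at
   each y, while the class of (max + 1) of the spectrum of u would be met
   (m + n + 2) / g - 1 times at u. These add up to 2 (m + 1) (n + 1) / g - 1,
   but the sum over all vertices counts every edge twice. A staircase coloring
   always has a single gap, at u.

   If g = 1, an interval coloring is built along Euclid's algorithm: going from
   (m, n) to (m, n + m + 1) adds m + 1 vertices y, completely joined to u and
   the x, and these edges are colored by a square array whose rows and columns
   are intervals starting where those of the vertices u, x have to be extended.
   Such squares are carried along: the square for the y and u of the new graph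
   is assembled from the two old squares and two copies of the old coloring. *)

Set Implicit Arguments.
Unset Strict Implicit.
Unset Printing Implicit Defensive.

(** * Two-colorings alternating under two involutions *)

(* No orbit of [f \o g] contains both [x] and [f x]: otherwise some conjugate of
   [f] or [g] by a power of [f \o g] would have a fixed point. *)
Lemma involutions_2coloring (S : finType) (f g : S -> S) :
  involutive f -> involutive g ->
  (forall x, f x != x) -> (forall x, g x != x) ->
  exists h : S -> bool, forall x, h (f x) = ~~ h x /\ h (g x) = ~~ h x.
Proof.
move=> fK gK f_fix g_fix.
pose c x := f (g x).
have c_inj : injective c by move=> x y /(inv_inj fK)/(inv_inj gK).
have cf x : c (f (c x)) = f x by rewrite /c fK gK.
have itercf n x : iter n c (f (iter n c x)) = f x.
  elim: n x => // n IHn x.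
  by rewrite iterSr [iter n.+1 c x]iterS cf.
have f_orbit x : ~~ fconnect c x (f x).
  apply/negP=> /iter_findex; set n := findex _ _ _ => c_n.
  rewrite -(odd_double_half n) in c_n.
  set k := n./2 in c_n.
  (* For the midpoint [y] of the walk, [y = iter k c x], this reads [f y = y] or [f y = f (g y)], so
     [f] or [g] would fix [y]. *)
  have: f (iter k c x) = iter (odd n + k) c x.
    have iter_inj j : injective (iter j c).
      by elim: j => // j IHj y z /c_inj/IHj.
    by apply: (iter_inj k); rewrite itercf -c_n -!iterD; congr iter; lia.
  case: (odd n) => /= [/(congr1 f)|]; last by move/eqP; rewrite (negPf (f_fix _)).
  by rewrite fK /c fK => /esym/eqP; rewrite (negPf (g_fix _)).
have sym_c := fconnect_sym c_inj.
pose rk x := enum_rank (froot c x).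
have rk_c x : rk (c x) = rk x.
  by rewrite /rk; congr enum_rank; apply/eqP;
    rewrite (root_connect sym_c) sym_c fconnect1.
have rk_gf x : rk (g x) = rk (f x).
  by rewrite -(rk_c (g x)) /c gK.
have rk_fg x : rk (f (g x)) = rk x by exact: rk_c.
have rk_neq x : rk (f x) != rk x.
  apply/eqP=> /enum_rank_inj/esym/eqP.
  by rewrite (root_connect sym_c) (negPf (f_orbit x)).
(* Both [f x] and [g x] lie in one orbit other than that of [x]; [h] records which of the two orbits
   has the smaller rank. *)
exists (fun x => rk x < rk (f x)) => x.
rewrite fK rk_gf rk_fg.
have: (rk (f x) : nat) != rk x by rewrite rk_neq.
by split; lia.
Qed.

(** * Bijections onto integer intervals, and arrays built from them *)

Definition fills (T : finType) (f : T -> nat) (s : nat) :=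
  injective f /\ forall t, s <= f t < s + #|T|.

(** An injection into an interval of [#|T|] integers is onto, so [fills] does express that a
    spectrum is an interval. *)
Lemma fills_surj (T : finType) (f : T -> nat) s c :
  fills f s -> s <= c < s + #|T| -> exists t, f t = c.
Proof.
case=> f_inj f_s c_s.
have sub : {subset codom f <= iota s #|T|}.
  by move=> _ /codomP[t ->]; rewrite mem_iota f_s.
have [||_ /(_ c)] := uniq_min_size _ sub.
- exact/injectiveP.
- by rewrite size_iota size_codom.
by rewrite mem_iota c_s => /codomP[t ->]; exists t.
Qed.

Lemma fills_mirror (T : finType) (f : T -> nat) s M :
  s + #|T| <= M.+1 -> fills f s ->
  fills (fun t => M - f t) (M.+1 - s - #|T|).
Proof.
move=> le_M [f_inj f_s]; split=> [t t' eq_t|t].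
  by apply: f_inj; have := f_s t; have := f_s t'; lia.
by have := f_s t; lia.
Qed.

Definition square (T : finType) (L : T -> T -> nat) (d : T -> nat) :=
  forall i, fills (L i) (d i) /\ fills (L^~ i) (d i).

(* The cells colored [P] or [P.+1] occur twice in each row and column meeting
   them, so they form a disjoint union of even cycles, along which the two colors
   can be redistributed; rows are governed by [M] and columns by [N]. *)
Lemma merge_square (T : finType) (M N : T -> T -> nat) (d : T -> nat) (P : nat) :
  (forall i, fills (M i) (d i)) -> (forall j, fills (N^~ j) (d j)) ->
  (forall i j, M i j != N i j -> P <= M i j <= P.+1 /\ P <= N i j <= P.+1) ->
  (forall i, (d i <= P < d i + #|T|) = (d i <= P.+1 < d i + #|T|)) ->
  exists L, square L d.
Proof.
move=> fillM fillN MN dP.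
pose inP c := P <= c <= P.+1; pose other c := P + P.+1 - c.
have inPN i j : inP (N i j) = inP (M i j).
  by have [->//|/MN[]] := eqVneq (M i j) (N i j); rewrite /inP; lia.
pose S := {x : T * T | inP (M x.1 x.2)}.
(* [f] moves a cell to the one with the other color in its row of [M]; [g], below, does the same in
   the columns of [N]. By [dP] the other color does occur there. *)
have /fin_all_exists[f fP] (x : S) : exists y : S,
    (val y).1 = (val x).1 /\
    M (val y).1 (val y).2 = other (M (val x).1 (val x).2).
  case: x => -[i j] /= Px.
  have [_ /(_ j) Mij] := fillM i.
  have [|j' Mij'] := @fills_surj _ _ _ (other (M i j)) (fillM i).
    by have := dP i; move: Px; rewrite /inP /other; lia.
  have Py : inP (M (i, j').1 (i, j').2).
    by move: Px; rewrite /= Mij' /inP /other; lia.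
  by exists (exist _ (i, j') Py).
have /fin_all_exists[g gP] (x : S) : exists y : S,
    (val y).2 = (val x).2 /\
    N (val y).1 (val y).2 = other (N (val x).1 (val x).2).
  case: x => -[i j] /= Px; rewrite -inPN in Px.
  have [_ /(_ i) Nij] := fillN j.
  have [|i' Nij'] := @fills_surj _ _ _ (other (N i j)) (fillN j).
    by have := dP j; move: Px Nij; rewrite /inP /other; lia.
  have Py : inP (M (i', j).1 (i', j).2).
    by rewrite -inPN; move: Px; rewrite /= Nij' /inP /other; lia.
  by exists (exist _ (i', j) Py).
have inS (x : S) : inP (M (val x).1 (val x).2) by exact: (valP x).
have inSN (x : S) : inP (N (val x).1 (val x).2) by rewrite inPN inS.
have eqS1 (x y : S) : (val x).1 = (val y).1 ->
    M (val x).1 (val x).2 = M (val y).1 (val y).2 -> x = y.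
  move=> e1 eM; apply: val_inj; move: e1 eM.
  case: (val x) (val y) => [i j] [i' j'] /= -> eM.
  by rewrite ((fillM i').1 _ _ eM).
have eqS2 (x y : S) : (val x).2 = (val y).2 ->
    N (val x).1 (val x).2 = N (val y).1 (val y).2 -> x = y.
  move=> e1 eM; apply: val_inj; move: e1 eM.
  case: (val x) (val y) => [i j] [i' j'] /= -> eM.
  by rewrite ((fillN j').1 _ _ eM).
have [||||h hP] := @involutions_2coloring S f g.
- move=> x; have [e1 eM] := fP x; have [e1' eM'] := fP (f x).
  apply: eqS1; first by rewrite e1' e1.
  by rewrite eM' eM; have := inS x; rewrite /inP /other; lia.
- move=> x; have [e1 eM] := gP x; have [e1' eM'] := gP (g x).
  apply: eqS2; first by rewrite e1' e1.
  by rewrite eM' eM; have := inSN x; rewrite /inP /other; lia.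
- move=> x; apply/eqP=> e; have [_] := fP x; rewrite e.
  by have := inS x; rewrite /inP /other; lia.
- move=> x; apply/eqP=> e; have [_] := gP x; rewrite e.
  by have := inSN x; rewrite /inP /other; lia.
pose H i j := if insub (i, j) is Some x then h (x : S) else false.
(* On the cells of [S], [h] chooses between [P] and [P.+1], alternating in rows by [f] and in
   columns by [g]; on all others [M] and [N] agree. *)
pose L i j := if inP (M i j) then P + H i j else M i j.
have HE i j (Pij : inP (M (i, j).1 (i, j).2)) : H i j = h (exist _ (i, j) Pij).
  by rewrite /H insubT.
have LP i j : inP (L i j) = inP (M i j).
  by rewrite /L; case: ifP => //; rewrite /inP; lia.
have LN i j : ~~ inP (M i j) -> L i j = N i j.
  rewrite /L => /[dup] nP /negPf->.
  by apply/eqP; apply: contraR nP => /MN[].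
exists L => i; split; split.
- move=> j j' eqL; have := LP i j; rewrite eqL LP.
  case: (boolP (inP (M i j))) => [Pj Pj'|nP nP']; last first.
    by move: eqL; rewrite /L nP' (negPf nP); apply: (fillM i).1.
  apply/eqP; apply: contraT => neq_j.
  have e : f (exist _ (i, j) Pj) = exist _ (i, j') Pj'.
    have [e1 eM] := fP (exist _ (i, j) Pj).
    apply: eqS1 => //=; rewrite eM /=.
    have : M i j != M i j' by apply: contra neq_j => /eqP/((fillM i).1 _ _)->.
    by move: (Pj) (Pj'); rewrite /inP /other; lia.
  have := (hP (exist _ (i, j) Pj)).1; rewrite e -!HE.
  by move: eqL; rewrite /L Pj Pj'; case: (H i j) (H i j') => [] [] //=; lia.
- move=> j; have [_ /(_ j) Mij] := fillM i; have := dP i.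
  by rewrite /L; case: ifP => //; move: Mij; case: (H i j); rewrite /inP; lia.
- move=> j j' eqL; have := LP j i; rewrite eqL LP.
  case: (boolP (inP (M j i))) => [Pj Pj'|nP nP']; last first.
    by move: eqL; rewrite !LN ?nP' //; apply: (fillN i).1.
  apply/eqP; apply: contraT => neq_j.
  have e : g (exist _ (j, i) Pj) = exist _ (j', i) Pj'.
    have [e1 eM] := gP (exist _ (j, i) Pj).
    apply: eqS2 => //=; rewrite eM /=.
    have : N j i != N j' i by apply: contra neq_j => /eqP/((fillN i).1 _ _)->.
    by move: (Pj) (Pj'); rewrite /= -!inPN /inP /other; lia.
  have := (hP (exist _ (j, i) Pj)).2; rewrite e -!HE.
  by move: eqL; rewrite /L Pj Pj'; case: (H j i) (H j' i) => [] [] //=; lia.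
- move=> j; have [_ /(_ j) Nij] := fillN i; have := dP i.
  case: (boolP (inP (M j i))) => [Pj|nP]; last by rewrite LN.
  move: Nij (Pj); rewrite -{1}inPN /L Pj /=; case: (H j i); rewrite /inP; lia.
Qed.

Lemma eq_fills (T : finType) (f g : T -> nat) s :
  f =1 g -> fills f s -> fills g s.
Proof.
move=> eq_fg [f_inj f_s]; split=> [t t'|t]; rewrite -!eq_fg //.
exact: f_inj.
Qed.

Lemma fills_shift (T : finType) (f g : T -> nat) s s' a :
  fills f s -> (forall t, g t = f t + a) -> s' = s + a -> fills g s'.
Proof.
move=> [f_inj f_s] gE ->; split=> [t t'|t]; rewrite !gE; first by move/addIn/f_inj.
by have := f_s t; lia.
Qed.

Lemma fills_bij (S T : finType) (f : T -> nat) s (e : S -> T) :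
  bijective e -> fills f s -> fills (f \o e) s.
Proof.
move=> e_bij [f_inj f_s]; split=> [|x]; last by rewrite (bij_eq_card e_bij) f_s.
exact: inj_comp f_inj (bij_inj e_bij).
Qed.

Lemma square_trmx (T : finType) (L : T -> T -> nat) d :
  square L d -> square (fun i j => L j i) d.
Proof. by move=> sqL i; have [] := sqL i. Qed.

(** The block of [A] sits directly below that of [B]. This is how a spectrum is extended downwards
    by the colors of new edges. *)
Lemma fills_glue (A B T : finType) (f : T -> nat) (i : A -> T) (j : B -> T) s :
  #|T| = #|A| + #|B| -> (forall t, (exists a, t = i a) \/ exists b, t = j b) ->
  fills (f \o i) s -> fills (f \o j) (s + #|A|) -> fills f s.
Proof.
move=> cardT cover [fi_inj fi_s] [fj_inj fj_s]; split=> [t t'|t].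
  case: (cover t) (cover t') => [[a ->]|[b ->]] [[a' ->]|[b' ->]].
  - by move/fi_inj->.
  - by have := fi_s a; have := fj_s b'; rewrite /=; lia.
  - by have := fi_s a'; have := fj_s b; rewrite /=; lia.
  - by move/fj_inj->.
rewrite cardT; case: (cover t) => [[a ->]|[b ->]].
  by have := fi_s a; rewrite /=; lia.
by have := fj_s b; rewrite /=; lia.
Qed.

(** * Interval colorings along Euclid's algorithm *)

(* An interval coloring of K_{1,m,n} in which [q] and [p] are the colors at u and
   the spectra at [x] and [y] start at [r x] and [c y]. In [QX] and [QY] the
   index [None] stands for u. Adding vertices y extends the spectra below, by
   [QX]; adding vertices x extends them above, by [QY], up to translation: with
   the colors shifted by one, its start [n] at u makes sense even for [n = 0]. *)
Variant scheme (m n : nat) : Prop :=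
  Scheme (X Y : finType) (r : X -> nat) (c : Y -> nat)
      (p : X -> nat) (q : Y -> nat) (k : X -> Y -> nat)
      (QX : option X -> option X -> nat) (QY : option Y -> option Y -> nat) of
    #|X| = m & #|Y| = n & (forall x, r x < m) & (forall y, c y < n)
    & fills p n & fills q 0
    & (forall x, fills (oapp (k x) (p x)) (r x))
    & (forall y, fills (oapp (k^~ y) (q y)) (c y))
    & square QX (oapp r 0) & square QY (oapp (fun y => (c y).+1) n).

Lemma scheme0 : scheme 0 0.
Proof.
have sq0 (f : void -> nat) : square (fun _ _ => 0) (oapp f 0).
  case=> [[]|]; split; split=> [[[]|] [[]|] //|[[]|]];
  by rewrite card_option card_void.
exists void void (fun=> 0) (fun=> 0) (fun=> 0) (fun=> 0) (fun _ _ => 0)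
  (fun _ _ => 0) (fun _ _ => 0); rewrite ?card_void //; try by case.
- by split; case.
- by split; case.
Qed.

(** Reversing the colors, [c] to [m + n - 1 - c], puts the colors of [p] below those of [q]. The
    squares trade places and are reversed about their own ranges, hence [n.*2] and [m.*2]. *)
Lemma scheme_sym m n : scheme m n -> scheme n m.
Proof.
case=> X Y r c p q k QX QY cardX cardY r_lt c_lt p_fill q_fill row col sqX sqY.
have p_bd x : n <= p x < n + m by have := p_fill.2 x; rewrite cardX.
have q_bd y : q y < n by have := q_fill.2 y; rewrite cardY.
pose M := (m + n).-1.
exists Y X (fun y => n.-1 - c y) (fun x => m.-1 - r x)
  (fun y => M - q y) (fun x => M - p x) (fun y x => M - k x y)
  (fun i j => n.*2 - QY i j) (fun i j => m.*2 - QX i j) => //.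
- by move=> y; have := c_lt y; lia.
- by move=> x; have := r_lt x; lia.
- split=> [y y' eq_q|y]; rewrite ?cardY.
    apply: q_fill.1; have := q_bd y; have := q_bd y'; rewrite /M in eq_q *; lia.
  by have := q_bd y; rewrite /M; lia.
- split=> [x x' eq_p|x]; rewrite ?cardX.
    apply: p_fill.1; have := p_bd x; have := p_bd x'; rewrite /M in eq_p *; lia.
  by have := p_bd x; rewrite /M; lia.
- move=> y; have := c_lt y => lt_cy.
  have := fills_mirror (M := M) _ (col y); rewrite card_option cardX.
  have -> : M.+1 - c y - m.+1 = n.-1 - c y by rewrite /M; lia.
  by move=> H; apply: eq_fills (H _) => [[]|] //; rewrite /M; lia.
- move=> x; have := r_lt x => lt_rx.
  have := fills_mirror (M := M) _ (row x); rewrite card_option cardY.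
  have -> : M.+1 - r x - n.+1 = m.-1 - r x by rewrite /M; lia.
  by move=> H; apply: eq_fills (H _) => [[]|] //; rewrite /M; lia.
- move=> i; have [rowQ colQ] := sqY i.
  have eq_i : oapp (fun y => n.-1 - c y) 0 i =
      n.*2.+1 - oapp (fun y => (c y).+1) n i - #|{: option Y}|.
    rewrite card_option cardY.
    by case: i {rowQ colQ} => [y|] /=; [have := c_lt y|]; lia.
  have le_i : oapp (fun y => (c y).+1) n i + #|{: option Y}| <= n.*2.+1.
    rewrite card_option cardY.
    by case: i {rowQ colQ eq_i} => [y|] /=; [have := c_lt y|]; lia.
  by rewrite eq_i; split; apply: fills_mirror.
- move=> i; have [rowQ colQ] := sqX i.
  have eq_i : oapp (fun x => (m.-1 - r x).+1) m i =
      m.*2.+1 - oapp r 0 i - #|{: option X}|.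
    rewrite card_option cardX.
    by case: i {rowQ colQ} => [x|] /=; [have := r_lt x|]; lia.
  have le_i : oapp r 0 i + #|{: option X}| <= m.*2.+1.
    rewrite card_option cardX.
    by case: i {rowQ colQ eq_i} => [x|] /=; [have := r_lt x|]; lia.
  by rewrite eq_i; split; apply: fills_mirror.
Qed.

Lemma scheme_step m n : scheme m n -> scheme m (n + m.+1).
Proof.
case=> X Y r c p q k QX QY cardX0 cardY0 r_lt c_lt p_fill q_fill row col sqX sqY.
have p_bd x : n <= p x < n + m by have := p_fill.2 x; rewrite cardX0.
have q_bd y : q y < n by have := q_fill.2 y; rewrite cardY0.
have [a aE] : exists a, a = m.+1 by exists m.+1.
have cardX : #|{: option X}| = a by rewrite card_option cardX0.
have cardY : #|{: option Y}| = n.+1 by rewrite card_option cardY0.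
have cardT : #|{: (Y + option X)%type}| = n + a by rewrite card_sum cardX cardY0.
pose T := option (Y + option X)%type.
pose newI (i : option X) : T := Some (inr i).
pose oldI (j : option Y) : T := omap inl j.
have cover t : (exists i, t = newI i) \/ exists j, t = oldI j.
  case: t => [[y|i]|]; first by right; exists (Some y).
    by left; exists i.
  by right; exists None.
have glue (f : T -> nat) s :
    fills (f \o newI) s -> fills (f \o oldI) (s + a) -> fills f s.
  move=> fI fJ; apply: (fills_glue _ cover fI); last by rewrite cardX.
  by rewrite card_option cardT cardX cardY; lia.
(* The vertex u occurs twice among the indices of the new square: as itself
   ([None]) and as the new vertex y coming from row u of [QX] ([Some (inr None)]).
   The two cells where these meet can be colored [n + a] and [(n + a).+1] so as to
   be right for the rows or right for the columns; [merge_square] reconciles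
   both. *)
pose Q QX QY kap lam (s t : T) := match s, t with
  | Some (inr i), Some (inr j) => (QX i j).+1
  | Some (inr (Some x)), Some (inl y)
  | Some (inl y), Some (inr (Some x)) => (k x y + a).+1
  | Some (inr (Some x)), None | None, Some (inr (Some x)) => (p x + a).+1
  | Some (inr None), Some (inl y) | Some (inl y), Some (inr None) => (q y + a).+1
  | None, Some (inr None) => kap
  | Some (inr None), None => lam
  | Some (inl y), Some (inl y') => QY (Some y) (Some y') + a.*2
  | Some (inl y), None => QY (Some y) None + a.*2
  | None, Some (inl y) => QY None (Some y) + a.*2
  | None, None => QY None None + a.*2
  end.
(* The spectrum of a new vertex [inr i] is column [i] of [QX], and so starts where row [i] does. *)
pose c' (t : Y + option X) := match t with inl y => c y + a | inr i => oapp r 0 i end.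
pose d : T -> nat := oapp (fun t => (c' t).+1) (n + a).
have fill_p : fills (oapp (fun x => (p x + a).+1) (n + a)) (n + a).
  split=> [[x|] [x'|] //= eq_p|[x|]]; rewrite ?cardX /=.
  - by congr Some; apply: p_fill.1; lia.
  - by have := p_bd x; lia.
  - by have := p_bd x'; lia.
  - by have := p_bd x; lia.
  - by lia.
have fill_q : fills (oapp (fun y => (q y + a).+1) (n + a).+1) a.+1.
  split=> [[y|] [y'|] //= eq_q|[y|]]; rewrite ?cardY /=.
  - by congr Some; apply: q_fill.1; lia.
  - by have := q_bd y; lia.
  - by have := q_bd y'; lia.
  - by have := q_bd y; lia.
  - by lia.
have fillQ QX' QY' : square QX' (oapp r 0) ->
    square QY' (oapp (fun y => (c y).+1) n) ->
    forall i, fills (Q QX' QY' (n + a) (n + a).+1 i) (d i).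
  move=> sqX' sqY' [[y|[x|]]|]; apply: glue => /=.
  - by apply: (fills_shift (a := a.+1) (col y)) => [[x|]|] /=; lia.
  - by apply: (fills_shift (a := a.*2) (sqY' (Some y)).1) => [[y'|]|] /=; lia.
  - by apply: (fills_shift (a := 1) (sqX' (Some x)).1) => [j|] /=; lia.
  - by apply: (fills_shift (a := a.+1) (row x)) => [[y|]|] /=; lia.
  - by apply: (fills_shift (a := 1) (sqX' None).1) => [j|] /=; lia.
  - by apply: (fills_shift (a := 0) fill_q) => [[y|]|] /=; lia.
  - by apply: (fills_shift (a := 0) fill_p) => [[x|]|] /=; lia.
  - by apply: (fills_shift (a := a.*2) (sqY' None).1) => [[y'|]|] /=; lia.
have fillM := fillQ _ _ sqX sqY.
(* Exchanging [kap] and [lam] amounts to transposing, so columns reduce to rows for the transposed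
   squares. *)
have fillN j : fills ((Q QX QY (n + a).+1 (n + a))^~ j) (d j).
  apply: (fills_shift (a := 0) (fillQ _ _ (square_trmx sqX) (square_trmx sqY) j)).
    by case: j => [[y|[x|]]|] [[y'|[x'|]]|] /=; lia.
  by lia.
have [||L sqL] := merge_square (P := n + a) fillM fillN.
- by move=> [[y|[x|]]|] [[y'|[x'|]]|]; rewrite /= ?eqxx //; lia.
(* Every row contains both [n + a] and [(n + a).+1]. *)
- case=> [[y|[x|]]|]; rewrite card_option cardT /=.
  + by have := c_lt y; lia.
  + by have := r_lt x; lia.
  + by lia.
  + by lia.
rewrite -aE.
(* Old colors move up by [a], and row [Some x] of [QX], or row [None] for u, fills the [a] colors
   thus freed. The starts [r] do not move, so [QX] is kept. *)
exists X (Y + option X)%type r c' (fun x => p x + a)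
  (fun t => match t with inl y => q y + a | inr i => QX None i end)
  (fun x t => match t with inl y => k x y + a | inr i => QX (Some x) i end)
  QX L => //.
- case=> [y|[x|]]; rewrite /=.
  + by have := c_lt y; lia.
  + by have := r_lt x; lia.
  + by lia.
- by exact: (fills_shift (a := a) p_fill).
- apply: (fills_glue (i := inr) (j := inl)).
  + by rewrite card_sum addnC.
  + by case=> [y|i]; [right; exists y|left; exists i].
  + exact: (sqX None).1.
  + by apply: (fills_shift (a := a) q_fill) => //; rewrite cardX.
- move=> x; apply: glue.
  + exact: (sqX (Some x)).1.
  + by apply: (fills_shift (a := a) (row x)) => [[y|]|].
- case=> [y|i] /=.
  + by apply: (fills_shift (a := a) (col y)) => [[x|]|].
  + by apply: (fills_shift (a := 0) (sqX i).2) => [[x|]|]; rewrite /= addn0.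
Qed.

(** Subtractive Euclid on [m.+1] and [n.+1]: [scheme_step] undoes a subtraction and [scheme_sym] a
    swap. Intermediate parts may be empty. *)
Lemma coprime_scheme m n : coprime m.+1 n.+1 -> scheme m n.
Proof.
have [s] := ubnP (m + n); elim: s m n => // s IHs m n lt_s.
wlog le_mn : m n lt_s / m <= n => [wlog_mn co_mn|].
  have [le_mn|/ltnW le_nm] := leqP m n; first exact: wlog_mn.
  by apply: scheme_sym; apply: wlog_mn => //; rewrite 1?addnC // coprime_sym.
move=> co_mn; have [eq_mn|neq_mn] := eqVneq m n.
  by move: co_mn; rewrite -eq_mn /coprime gcdnn => /eqP[->]; exact: scheme0.
have -> : n = (n - m).-1 + m.+1 by lia.
apply: scheme_step; apply: IHs; first by lia.
have -> : (n - m).-1.+1 = n.+1 - m.+1 by lia.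
have n_eq : n.+1 = (n.+1 - m.+1) + m.+1 by lia.
by move: co_mn; rewrite {1}n_eq /coprime gcdnDr.
Qed.

(** * Deficiency of finite sets of integers *)

Lemma bigmin_le (s : seq nat) x c : c \in s -> \big[minn/x]_(i <- s) i <= c.
Proof.
elim: s => // y s IHs; rewrite inE big_cons geq_min => /orP[/eqP->|/IHs->].
  by rewrite leqnn.
by rewrite orbT.
Qed.

Lemma fset_max_ge (A : {fset nat}) c : c \in A -> c <= fset_max A.
Proof. by move=> cA; exact: (@leq_bigmax_seq _ (enum_fset A) xpredT id c cA isT). Qed.

Lemma def_set_le (A : {fset nat}) s len :
  {in A, forall c, s <= c < s + len} -> def_set A <= len - #|` A|.
Proof.
have [->|[c0 c0A]] := fset_0Vmem A.
  by rewrite /def_set /fset_max /fset_min big_seq_fset0.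
move=> As; rewrite /def_set.
have c_le : fset_max A <= (s + len).-1.
  by rewrite /fset_max big_seq; apply/bigmax_leqP_seq => i iA _; have := As i iA; lia.
have s_le : s <= fset_min A.
  rewrite /fset_min big_seq; elim/big_ind: _ => [|x y|i iA].
  - have := As c0 c0A; have := fset_max_ge c0A; lia.
  - by rewrite leq_min => -> ->.
  - by have /andP[] := As i iA.
have A_gt0 : 0 < #|` A| by rewrite cardfs_gt0; apply/fset0Pn; exists c0.
by lia.
Qed.

(** No integer is missing between minimum and maximum. The [perm_eq] form turns sums over a spectrum
    into sums over consecutive integers. *)
Lemma def_set0_perm (A : {fset nat}) :
  def_set A = 0 -> perm_eq A (iota (fset_min A) #|` A|).
Proof.
move=> defA; have subA : {subset A <= iota (fset_min A) #|` A|}.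
  move=> c cA; rewrite mem_iota bigmin_le // andTb.
  have : 0 < #|` A| by rewrite cardfs_gt0; apply/fset0Pn; exists c.
  by have := fset_max_ge cA; move: defA; rewrite /def_set; lia.
have [|_ eqA] := uniq_min_size (fset_uniq A) subA; first by rewrite size_iota.
exact: (uniq_perm (fset_uniq A) (iota_uniq _ _) eqA).
Qed.

(** * Spectra of proper edge-colorings *)

Section EdgeColorings.

Variable G : sgraph.
Implicit Types (v w : G) (alpha : {set G} -> nat).

Let nbr v := [set w | adj v w].

Lemma edge_in v w : adj v w -> [set v; w] \in edges G.
Proof. by move=> vw; apply/imset2P; exists v w; rewrite ?inE. Qed.

Lemma edge_at (e : {set G}) v :
  e \in edges G -> v \in e -> exists2 w, adj v w & e = [set v; w].
Proof.
case/imset2P=> x y _; rewrite !inE => /andP[_ xy] ->.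
rewrite !inE => /orP[]/eqP->; first by exists y.
by exists x; rewrite 1?adj_sym // setUC.
Qed.

Lemma edge_inj v w w' : adj v w -> [set v; w] = [set v; w'] -> w = w'.
Proof.
move=> vw e; have: w \in [set v; w'] by rewrite -e !inE eqxx orbT.
by rewrite !inE => /orP[/eqP wv|/eqP//]; rewrite wv adj_irr in vw.
Qed.

Lemma spectrumP alpha v c :
  reflect (exists2 w, adj v w & alpha [set v; w] = c) (c \in spectrum alpha v).
Proof.
apply: (iffP idP) => [/imfsetP[e /=]|[w vw <-]].
  by rewrite inE => /andP[eG /(edge_at eG)[w vw ->]] ->; exists w.
by apply/imfsetP; exists [set v; w]; rewrite //= !inE eqxx edge_in.
Qed.

Lemma proper_inj t alpha v : proper_edge_coloring t alpha ->
  {in nbr v &, injective (fun w => alpha [set v; w])}.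
Proof.
case=> _ _ proper w w'; rewrite !inE => vw vw' eq_a.
apply: (edge_inj vw); apply/eqP; apply: contraPT eq_a => neq_e; apply/eqP.
apply: proper; rewrite ?edge_in //.
by apply/set0Pn; exists v; rewrite !inE eqxx.
Qed.

Lemma spectrum_perm t alpha v : proper_edge_coloring t alpha ->
  perm_eq [seq alpha [set v; w] | w <- enum (nbr v)] (spectrum alpha v).
Proof.
move=> proper; apply: uniq_perm.
- rewrite map_inj_in_uniq ?enum_uniq // => w w'.
  by rewrite !mem_enum; exact: (proper_inj proper).
- exact: fset_uniq.
move=> c; apply/mapP/spectrumP => [[w]|[w vw <-]].
  by rewrite mem_enum inE => vw ->; exists w.
by exists w; rewrite // mem_enum inE.
Qed.

Lemma card_spectrum t alpha v : proper_edge_coloring t alpha ->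
  #|` spectrum alpha v| = #|nbr v|.
Proof. by move/(@spectrum_perm _ _ v)/perm_size; rewrite size_map -cardE. Qed.

(** The start [s] serves all weights [F]; the lower bound takes for [F] the indicator of a residue
    class. *)
Lemma def_vertex0_sum t alpha v : proper_edge_coloring t alpha ->
  def_vertex alpha v = 0 -> exists s, forall F : nat -> nat,
  \sum_(w | adj v w) F (alpha [set v; w]) = \sum_(s <= c < s + #|nbr v|) F c.
Proof.
move=> proper /def_set0_perm; rewrite (card_spectrum _ proper) => permS.
exists (fset_min (spectrum alpha v)) => F.
rewrite /index_iota addKn -(perm_big _ permS) -(perm_big _ (spectrum_perm v proper)).
by rewrite big_map big_enum /=; apply: eq_bigl => w; rewrite inE.
Qed.

(** Colors given on ordered pairs suffice for upper bounds: a vertex contributes at most the length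
    of a window around its spectrum minus its degree. *)
Lemma deficiency_le (col : G -> G -> nat) t (lo len : G -> nat) :
  (forall v w, col v w = col w v) ->
  (forall v, {in nbr v &, injective (col v)}) ->
  (forall v w, adj v w -> 1 <= col v w <= t) ->
  (forall c, 1 <= c <= t -> exists v w, adj v w /\ col v w = c) ->
  (forall v w, adj v w -> lo v <= col v w < lo v + len v) ->
  deficiency G <= \sum_v (len v - #|nbr v|).
Proof.
move=> col_sym col_inj col_t col_onto col_lo.
(* On an edge the diagonal terms are 0 and the two orders of the ends agree, so the maximum is the
   common value of [col]. *)
pose alpha (e : {set G}) :=
  \max_(x in e) \max_(y in e) (if adj x y then col x y else 0).
have alphaE v w : adj v w -> alpha [set v; w] = col v w.
  move=> vw; have neq_vw : v \notin [set w].
    by rewrite inE; apply: contraTneq vw => ->; rewrite adj_irr.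
  rewrite /alpha (big_setU1 _ neq_vw) big_set1 !(big_setU1 _ neq_vw) !big_set1 /=.
  by rewrite !adj_irr vw adj_sym vw (col_sym w) maxn0 max0n maxnn.
have proper : proper_edge_coloring t alpha.
  split=> [e /imset2P[v w _]|c /col_onto[v [w [vw <-]]]|e f eG fG neq_ef].
  - by rewrite !inE => /andP[_ vw] ->; rewrite alphaE ?col_t.
  - by exists [set v; w]; rewrite ?edge_in ?alphaE.
  case/set0Pn=> v; rewrite inE => /andP[/(edge_at eG)[w vw e_vw]].
  case/(edge_at fG)=> w' vw' f_vw'; move: neq_ef; rewrite e_vw f_vw'.
  by rewrite !alphaE //; apply: contraNneq => /col_inj->; rewrite ?inE.
have : attained_def G (def_coloring alpha) by exists t, alpha.
rewrite /deficiency; case: ex_minnP => d _ min_d /boolp.asboolP/min_d/leq_trans->//.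
apply: leq_sum => v _; rewrite -(card_spectrum v proper).
by apply: (@def_set_le _ (lo v)) => c /spectrumP[w vw <-]; rewrite alphaE ?col_lo.
Qed.

End EdgeColorings.

(** * Bounds for complete tripartite graphs *)

Lemma sum_residue s q g rho : 0 < g ->
  \sum_(s <= c < s + q * g) (c == rho %[mod g]) = q.
Proof.
move=> g_gt0; have block s0 : \sum_(s0 <= c < s0 + g) (c == rho %[mod g]) = 1.
  elim: s0 => [|s0 IHs].
    rewrite add0n big_mkord (bigD1 (Ordinal (ltn_pmod rho g_gt0))) //=.
    rewrite modn_mod eqxx big1 // => i neq_i.
    by apply/eqP; rewrite eqb0 modn_small.
  (* Sliding the window by one trades [s0] for the congruent [s0 + g]. *)
  rewrite addSn big_nat_recr /=; last by lia.
  by move: IHs; rewrite big_ltn ?modnDr 1?addnC //; lia.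
elim: q => [|q IHq]; first by rewrite mul0n addn0 big_geq.
rewrite (@big_cat_nat _ _ _ (s + q * g)) ?leq_addr //=; last by lia.
by rewrite IHq mulSnr addnA block addn1.
Qed.

Section Tripartite.

Variables m n : nat.
Let G := complete_tripartite 1 m n.
Let u : G := inl (inl ord0).
Let vx (i : 'I_m) : G := inl (inr i).
Let vy (j : 'I_n) : G := inr j.

Lemma big_tripartite (F : G -> nat) :
  \sum_v F v = F u + (\sum_i F (vx i) + \sum_j F (vy j)).
Proof. by rewrite big_sumType /= big_sumType /= big_ord1 addnA. Qed.

Lemma sum_nbr_u (F : G -> nat) :
  \sum_(w | adj u w) F w = \sum_i F (vx i) + \sum_j F (vy j).
Proof. by rewrite big_mkcond big_tripartite. Qed.

Lemma sum_nbr_x (F : G -> nat) i :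
  \sum_(w | adj (vx i) w) F w = F u + \sum_j F (vy j).
Proof. by rewrite big_mkcond big_tripartite /= [X in _ + (X + _)]big1. Qed.

Lemma sum_nbr_y (F : G -> nat) j :
  \sum_(w | adj (vy j) w) F w = F u + \sum_i F (vx i).
Proof.
by rewrite big_mkcond big_tripartite /= [X in _ + (_ + X)]big1 // addn0.
Qed.

Lemma card_nbr_u : #|[set w | adj u w]| = m + n.
Proof. by rewrite -sum1dep_card sum_nbr_u !sum1_card !card_ord. Qed.

Lemma card_nbr_x i : #|[set w | adj (vx i) w]| = n.+1.
Proof. by rewrite -sum1dep_card sum_nbr_x sum1_card card_ord. Qed.

Lemma card_nbr_y j : #|[set w | adj (vy j) w]| = m.+1.
Proof. by rewrite -sum1dep_card sum_nbr_y sum1_card card_ord. Qed.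

(** Windows at x and y have exactly the degree as length, so only u, with window [1] to [t], can
    contribute. Colors start at 0 here and are raised by one in [f]. *)
Lemma tripartite_deficiency_le (p : 'I_m -> nat) (q : 'I_n -> nat)
    (k : 'I_m -> 'I_n -> nat) (r : 'I_m -> nat) (c : 'I_n -> nat) t :
  injective p -> injective q -> (forall i j, p i != q j) ->
  (forall i, p i < t) -> (forall j, q j < t) -> (forall i j, k i j < t) ->
  (forall d, d < t ->
    [\/ exists i, p i = d, exists j, q j = d | exists i j, k i j = d]) ->
  (forall i, fills (oapp (k i) (p i)) (r i)) ->
  (forall j, fills (oapp (k^~ j) (q j)) (c j)) ->
  deficiency G <= t - (m + n).
Proof.
move=> p_inj q_inj pq p_t q_t k_t onto row col.
pose f (v w : G) := match v, w with
  | inl (inl _), inl (inr i) | inl (inr i), inl (inl _) => (p i).+1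
  | inl (inl _), inr j | inr j, inl (inl _) => (q j).+1
  | inl (inr i), inr j | inr j, inl (inr i) => (k i j).+1
  | _, _ => 0
  end.
pose lo (v : G) := match v with
  | inl (inl _) => 1 | inl (inr i) => (r i).+1 | inr j => (c j).+1 end.
pose len (v : G) := match v with
  | inl (inl _) => t | inl (inr i) => n.+1 | inr j => m.+1 end.
apply: leq_trans (@deficiency_le G f t lo len _ _ _ _ _) _.
- by move=> [[?|?]|?] [[?|?]|?].
- move=> [[o|i]|j] [[o1|i1]|j1] [[o2|i2]|j2]; rewrite !inE //= => _ _.
  + by case=> /p_inj->.
  + by case=> /eqP; rewrite (negPf (pq _ _)).
  + by case=> /esym/eqP; rewrite (negPf (pq _ _)).
  + by case=> /q_inj->.
  + by rewrite (ord1 o1) (ord1 o2).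
  + by case=> /((row i).1 None (Some j2)).
  + by case=> /((row i).1 (Some j1) None).
  + by case=> /((row i).1 (Some j1) (Some j2)) []->.
  + by rewrite (ord1 o1) (ord1 o2).
  + by case=> /((col j).1 None (Some i2)).
  + by case=> /((col j).1 (Some i1) None).
  + by case=> /((col j).1 (Some i1) (Some i2)) []->.
- by move=> [[?|?]|?] [[?|?]|?] //= _; rewrite ?p_t ?q_t ?k_t.
- case=> // d /onto[[i <-]|[j <-]|[i [j <-]]].
  + by exists u, (vx i).
  + by exists u, (vy j).
  + by exists (vx i), (vy j).
- move=> [[o|i]|j] [[o1|i1]|j1] //= _.
  + by rewrite add1n !ltnS p_t.
  + by rewrite add1n !ltnS q_t.
  + by have := (row i).2 None; rewrite card_option card_ord /=; lia.
  + by have := (row i).2 (Some j1); rewrite card_option card_ord /=; lia.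
  + by have := (col j).2 None; rewrite card_option card_ord /=; lia.
  + by have := (col j).2 (Some i1); rewrite card_option card_ord /=; lia.
rewrite big_tripartite /= card_nbr_u.
rewrite big1 => [|i _]; last by rewrite card_nbr_x subnn.
by rewrite big1 => [|j _]; rewrite ?card_nbr_y ?subnn // !addn0.
Qed.

(** In this staircase u misses only color [m] among [0] to [m + n]; that color still occurs, on the
    edge joining the first x to the first y. *)
Lemma tripartite_deficiency_le1 : 0 < m -> 0 < n -> deficiency G <= 1.
Proof.
move=> m_gt0 n_gt0; have -> : 1 = (m + n).+1 - (m + n) by rewrite subSnn.
apply: (@tripartite_deficiency_le (fun i => m.-1 - i) (fun j => m.+1 + j)
  (fun i j => m + j - i) (fun i => m.-1 - i) (fun j => j.+1)).
- move=> i i' /= eq_ii'; apply: val_inj => /=.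
  by have := ltn_ord i; have := ltn_ord i'; lia.
- by move=> j j' /= /addnI/val_inj.
- by move=> i j /=; lia.
- by move=> i /=; lia.
- by move=> j /=; have := ltn_ord j; lia.
- by move=> i j /=; have := ltn_ord j; lia.
- move=> d lt_d; have [lt_dm|] := ltnP d m.
    have lt_i : m.-1 - d < m by lia.
    by apply: Or31; exists (Ordinal lt_i) => /=; lia.
  rewrite leq_eqVlt => /orP[/eqP<-|lt_md].
    by apply: Or33; exists (Ordinal m_gt0), (Ordinal n_gt0) => /=; lia.
  have lt_j : d - m.+1 < n by lia.
  by apply: Or32; exists (Ordinal lt_j) => /=; lia.
- move=> i; split=> [[j|] [j'|] //=|[j|]]; rewrite ?card_option ?card_ord /=.
  + by move=> eq_jj'; congr Some; apply: val_inj => /=; have := ltn_ord i; lia.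
  + by have := ltn_ord i; lia.
  + by have := ltn_ord i; lia.
  + by have := ltn_ord i; have := ltn_ord j; lia.
  + by lia.
- move=> j; split=> [[i|] [i'|] //=|[i|]]; rewrite ?card_option ?card_ord /=.
  + move=> eq_ii'; congr Some; apply: val_inj => /=.
    by have := ltn_ord i; have := ltn_ord i'; lia.
  + by have := ltn_ord i; lia.
  + by have := ltn_ord i'; lia.
  + by have := ltn_ord i; lia.
  + by lia.
Qed.

(** A scheme uses the colors below [m + n], and u sees all of them, so the bound is
    [(m + n) - (m + n)]. *)
Lemma tripartite_deficiency0 : scheme m n -> deficiency G = 0.
Proof.
case=> X Y r c p q k QX QY cardX cardY r_lt c_lt p_fill q_fill row col _ _.
have [x_ x_bij] : exists e : 'I_m -> X, bijective e.
  by case: _ / cardX; exists enum_val; exact: enum_val_bij.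
have [y_ y_bij] : exists e : 'I_n -> Y, bijective e.
  by case: _ / cardY; exists enum_val; exact: enum_val_bij.
have p_bd x : n <= p x < n + m by have := p_fill.2 x; rewrite cardX.
have q_bd y : q y < n by have := q_fill.2 y; rewrite cardY.
have omap_bij (S T : finType) (e : S -> T) : bijective e -> bijective (omap e).
  by case=> e' eK e'K; exists (omap e'); case=> //= z; rewrite ?eK ?e'K.
apply/eqP; rewrite -leqn0 -(subnn (m + n)).
apply: (@tripartite_deficiency_le (p \o x_) (q \o y_) (fun i j => k (x_ i) (y_ j))
  (r \o x_) (c \o y_)).
- exact: inj_comp p_fill.1 (bij_inj x_bij).
- exact: inj_comp q_fill.1 (bij_inj y_bij).
- by move=> i j /=; have := p_bd (x_ i); have := q_bd (y_ j); lia.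
- by move=> i /=; have := p_bd (x_ i); lia.
- by move=> j /=; have := q_bd (y_ j); lia.
- move=> i j; have := (row (x_ i)).2 (Some (y_ j)); have := r_lt (x_ i).
  by rewrite card_option cardY /=; lia.
- move=> d lt_d; have [lt_dn|le_nd] := ltnP d n.
    have [|y <-] := fills_surj (c := d) q_fill; first by rewrite cardY.
    by have [y' _ y'K] := y_bij; apply: Or32; exists (y' y); rewrite /= y'K.
  have [|x <-] := fills_surj (c := d) p_fill; first by rewrite cardX; lia.
  by have [x' _ x'K] := x_bij; apply: Or31; exists (x' x); rewrite /= x'K.
- move=> i; apply: eq_fills (fills_bij (omap_bij _ _ _ y_bij) (row (x_ i))).
  by case.
- move=> j; apply: eq_fills (fills_bij (omap_bij _ _ _ x_bij) (col (y_ j))).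
  by case.
Qed.

Lemma tripartite_deficiency_gt0 g : 1 < g -> g %| m.+1 -> g %| n.+1 ->
  0 < deficiency G.
Proof.
move=> g_gt1 /dvdnP[a am] /dvdnP[b bn].
rewrite lt0n /deficiency; case: ex_minnP => d /boolp.asboolP[t [alpha [proper <-]]] _.
rewrite /def_coloring sum_nat_eq0; apply/negP=> /forallP def0.
have sumF v : exists s, forall F : nat -> nat,
    \sum_(w | adj v w) F (alpha [set v; w]) =
    \sum_(s <= c < s + #|[set w | adj v w]|) F c.
  by apply: def_vertex0_sum proper _; apply/eqP/(implyP (def0 v)).
have [s sumU] := sumF u.
pose rho := s + (m + n); pose F c : nat := c == rho %[mod g].
pose f v w := F (alpha [set v; w]).
have fC v w : f v w = f w v by rewrite /f setUC.
have countX i : f (vx i) u + \sum_j f (vx i) (vy j) = b.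
  have [s' /(_ F)] := sumF (vx i); rewrite card_nbr_x bn sum_residue 1?ltnW //.
  by rewrite sum_nbr_x.
have countY j : f (vy j) u + \sum_i f (vy j) (vx i) = a.
  have [s' /(_ F)] := sumF (vy j); rewrite card_nbr_y am sum_residue 1?ltnW //.
  by rewrite sum_nbr_y.
(* Two more integers after the spectrum of u make [(a + b) * g] consecutive ones. The first added is
   [rho], in the class; the second is not, as [g > 1]. *)
have countU : (\sum_i f u (vx i) + \sum_j f u (vy j)).+1 = a + b.
  move: (sumU F); rewrite card_nbr_u sum_nbr_u -/(f _ _) => ->.
  rewrite -[RHS](@sum_residue s _ g rho) 1?ltnW // mulnDl -am -bn.
  have -> : s + (m.+1 + n.+1) = (s + (m + n)).+2 by lia.
  rewrite big_nat_recr; last by lia.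
  rewrite big_nat_recr /=; last by lia.
  rewrite -/rho eqxx -addn1 eqn_mod_dvd ?leqnSn //.
  by rewrite subSnn dvdn1 gtn_eqF // addn0 addn1.
have totX : \sum_i f u (vx i) + \sum_i \sum_j f (vx i) (vy j) = m * b.
  rewrite -big_split -[m in RHS]card_ord -sum_nat_const /=.
  by apply: eq_bigr => i _; rewrite fC countX.
have totY : \sum_j f u (vy j) + \sum_i \sum_j f (vx i) (vy j) = n * a.
  rewrite exchange_big -big_split -[n in RHS]card_ord -sum_nat_const /=.
  by apply: eq_bigr => j _; rewrite fC -(countY j); under eq_bigr do rewrite fC.
have eqab : m.+1 * b = n.+1 * a by rewrite am bn; lia.
(* With [e] the count over the edges between x and y, the totals add up to
   [m * b + n * a = a + b - 1 + 2 * e]; by [eqab] the left side is [2 * (m.+1 * b) - (a + b)], and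
   parity fails. *)
by move: totX totY countU; lia.
Qed.

End Tripartite.

Theorem theorem3p4 (m n : nat) (hm : 0 < m) (hn : 0 < n) :
  deficiency (complete_tripartite 1 m n) =
    if gcdn (m + 1) (n + 1) == 1 then 0 else 1.
Proof.
rewrite !addn1; case: ifP => [co_mn|/negbT gcd_neq1].
  exact/tripartite_deficiency0/coprime_scheme.
apply/eqP; rewrite eqn_leq tripartite_deficiency_le1 //=.
apply: (@tripartite_deficiency_gt0 _ _ (gcdn m.+1 n.+1));
  rewrite ?dvdn_gcdl ?dvdn_gcdr //.
by rewrite ltn_neqAle eq_sym gcd_neq1 gcdn_gt0.
Qed.
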